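(* Let $x_1, x_2$ be indeterminates over $\mathbb{C}$. The four quaternion algebras \[ (x_1,x_2),\qquad (x_1,x_2+1),\qquad (x_2,x_1+1),\qquad (x_2,x_1x_2+1) \] over the field $\mathbb{C}(x_1,x_2)$ do not share a common maximal subfield; that is, there is no quadratic field extension $L$ of $\mathbb{C}(x_1,x_2)$ that embeds as a subfield into each of these four algebras.
   Context: For a field $F$ of characteristic not $2$ and $a,b\in F^\times$, $(a,b)$ denotes the quaternion algebra over $F$ generated by $i,j$ subject to $i^2=a$, $j^2=b$, $ij=-ji$. A maximal subfield of a quaternion division algebra is a subfield that is a quadratic extension of the center. *)

(* Defs.v *)
From HB Require Import structures.
From mathcomp Require Import all_boot all_algebra all_field fraction.
From mathcomp Require Import complex Rstruct.
Set Implicit Arguments. Unset Strict Implicit. Unset Printing Implicit Defensive.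
Import GRing.Theory.
Local Open Scope ring_scope.

Definition CC : fieldType := complex Rdefinitions.R.

Definition FF : fieldType := {fraction {poly {poly CC}}}.

Definition x1 : FF := tofrac (('X : {poly CC})%:P).
Definition x2 : FF := tofrac ('X : {poly {poly CC}}).

(* The quaternion algebra (a,b) over a field F: F-basis 1, i, j, k = ij,
   with i^2 = a, j^2 = b, ij = -ji.  Elements q0 + q1 i + q2 j + q3 k. *)
Record quat (F : fieldType) (a b : F) := Quat { q0 : F; q1 : F; q2 : F; q3 : F }.

Definition qadd (F : fieldType) (a b : F) (x y : quat a b) : quat a b :=
  Quat a b (q0 x + q0 y) (q1 x + q1 y) (q2 x + q2 y) (q3 x + q3 y).

Definition qscale (F : fieldType) (a b : F) (c : F) (x : quat a b) : quat a b :=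
  Quat a b (c * q0 x) (c * q1 x) (c * q2 x) (c * q3 x).

Definition qone (F : fieldType) (a b : F) : quat a b := Quat a b 1 0 0 0.

(* Multiplication table: i^2 = a, j^2 = b, k^2 = -ab, ij = k = -ji,
   ik = a j = -ki, jk = -b i = -kj. *)
Definition qmul (F : fieldType) (a b : F) (x y : quat a b) : quat a b :=
  Quat a b
    (q0 x * q0 y + a * q1 x * q1 y + b * q2 x * q2 y - a * b * q3 x * q3 y)
    (q0 x * q1 y + q1 x * q0 y - b * q2 x * q3 y + b * q3 x * q2 y)
    (q0 x * q2 y + q2 x * q0 y + a * q1 x * q3 y - a * q3 x * q1 y)
    (q0 x * q3 y + q3 x * q0 y + q1 x * q2 y - q2 x * q1 y).

Definition quat_embedding (F : fieldType) (a b : F) (L : fieldExtType F)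
    (f : L -> quat a b) : Prop :=
  [/\ injective f,
      forall (c : F) (x y : L), f (c *: x + y) = qadd (qscale c (f x)) (f y),
      f 1 = qone a b &
      forall x y : L, f (x * y) = qmul (f x) (f y)].

Definition embeds_in_quat (F : fieldType) (L : fieldExtType F) (a b : F) : Prop :=
  exists f : L -> quat a b, quat_embedding f.

(* Main.v *)
(* A quadratic extension F(w) with w^2 = c embeds in (a,b) only if c is a value
   of the pure form a x^2 + b y^2 - a b z^2, so a common maximal subfield gives
   a non-trivial solution of a system equating the pure forms of the four
   algebras.  Such a system has no solution, as is seen by reducing it modulo 2:
   clear denominators, and choose a valuation subring A of C in which 2 is not
   invertible (Zorn); after scaling, all the coefficients are in A and one of
   them is 1.  Over a field k of characteristic 2 the squares form a subfield of
   k(x1^2,x2^2).  Write an element of k(x1,x2) as n0 + n1 x1 + n2 x2 + n12 x1 x2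
   with coordinates in k(x1^2,x2^2): the values of the four forms satisfy
   n0 = 0, n0 = n2, n0 = n1 and n0 = n12 respectively, so a common value is 0,
   and each form is anisotropic. *)
Require Import Defs.
From HB Require Import structures.
From mathcomp Require Import all_boot all_algebra all_field fraction.
From mathcomp Require Import complex Rstruct boolp classical_sets ring zify.
Set Implicit Arguments.
Unset Strict Implicit.
Unset Printing Implicit Defensive.
Import GRing.Theory.
Local Open Scope quotient_scope.
Local Open Scope classical_set_scope.
Local Open Scope ring_scope.

(** * Subrings given as sets, polynomials over them, adjunction of an element *)

Definition subring_set (K : pzRingType) (A : set K) : Prop :=
  [/\ A 1, forall x y, A x -> A y -> A (x - y)
    & forall x y, A x -> A y -> A (x * y)].

Section SubringSet.
Variables (K : pzRingType) (A : set K).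
Hypothesis Aring : subring_set A.

Lemma subring_set1 : A 1. Proof. by case: Aring. Qed.

Lemma subring_setB x y : A x -> A y -> A (x - y).
Proof. by case: Aring => _ + _; apply. Qed.

Lemma subring_setM x y : A x -> A y -> A (x * y).
Proof. by case: Aring => _ _; apply. Qed.

Lemma subring_set0 : A 0.
Proof. by rewrite -(subrr 1); apply: subring_setB; apply: subring_set1. Qed.

Lemma subring_setN x : A x -> A (- x).
Proof. by rewrite -sub0r; apply/subring_setB/subring_set0. Qed.

Lemma subring_setD x y : A x -> A y -> A (x + y).
Proof. by move=> Ax Ay; rewrite -[y]opprK; apply/subring_setB/subring_setN. Qed.

Lemma subring_setX x n : A x -> A (x ^+ n).
Proof.
move=> Ax; elim: n => [|n IHn]; first exact: subring_set1.
by rewrite exprS; apply: subring_setM.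
Qed.

Lemma subring_set_sum (I : Type) (r : seq I) (P : pred I) (F : I -> K) :
  (forall i, P i -> A (F i)) -> A (\sum_(i <- r | P i) F i).
Proof.
by move=> AF; apply: big_ind => //; [exact: subring_set0|exact: subring_setD].
Qed.

End SubringSet.

Definition poly_over_set (K : nzRingType) (A : set K) : set {poly K} :=
  [set p : {poly K} | forall i, A p`_i].

Lemma subring_set_poly (K : nzRingType) (A : set K) :
  subring_set A -> subring_set (poly_over_set A).
Proof.
move=> Ar; split=> [i|p q Ap Aq i|p q Ap Aq i].
- by rewrite coef1; case: (i == 0)%N;
    [exact: subring_set1 | exact: subring_set0].
- by rewrite coefB; apply: subring_setB.
- by rewrite coefM; apply: subring_set_sum => // j _; apply: subring_setM.
Qed.

Definition adjoin_set (K : nzRingType) (A : set K) (t : K) : set K :=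
  [set p.[t] | p in poly_over_set A].

Section Adjoin.
Variables (K : fieldType) (A : set K) (t : K).
Hypothesis Aring : subring_set A.

Lemma subring_set_adjoin : subring_set (adjoin_set A t).
Proof.
have Pr := subring_set_poly Aring.
split=> [|x y [p Ap <-] [q Aq <-]|x y [p Ap <-] [q Aq <-]].
- by exists 1; [exact: subring_set1 | rewrite hornerC].
- by exists (p - q); [exact: (subring_setB Pr) | rewrite !hornerE].
- by exists (p * q); [exact: (subring_setM Pr) | rewrite !hornerE].
Qed.

Lemma poly_over_setC a : A a -> poly_over_set A a%:P.
Proof.
by move=> Aa i; rewrite coefC; case: (i == 0)%N => //; exact: subring_set0.
Qed.

Lemma sub_adjoin_set : A `<=` adjoin_set A t.
Proof.
by move=> a Aa; exists a%:P; [exact: poly_over_setC | rewrite hornerC].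
Qed.

Lemma mem_adjoin_set : adjoin_set A t t.
Proof.
exists 'X; last by rewrite hornerX.
move=> i; rewrite coefX; case: (i == 1)%N;
  [exact: subring_set1 | exact: subring_set0].
Qed.

End Adjoin.

(** * Valuation rings as maximal subrings that avoid a given inverse *)

Section MaximalSubring.
Variables (K : fieldType) (A : set K) (e : K).
Hypotheses (Aring : subring_set A) (Ae : A e) (nAVe : ~ A e^-1).
Hypothesis Amax : forall t, ~ A t -> adjoin_set A t e^-1.

Let e_neq0 : e != 0.
Proof.
by apply/eqP => e0; apply: nAVe; rewrite e0 invr0; exact: subring_set0.
Qed.

Let no_mulV a : A a -> e * a <> 1.
Proof. by move=> Aa ea1; apply: nAVe; rewrite -[e^-1]mulr1 -ea1 mulKf. Qed.

(** Otherwise maximality makes [e^-1] a polynomial in [s^-1] over [A]. Clearing denominators puts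
    [s ^+ n * e^-1] in [A]; as [s ^+ n = 1 - e * d] with [d] in [A], so is [e^-1], a
    contradiction. *)
Lemma maximal_subring_unit a : A a -> A (1 - e * a)^-1.
Proof.
move=> Aa; set s := 1 - e * a; apply: contrapT => /Amax [p Ap Hp].
have As : A s.
  by apply: subring_setB => //; [exact: subring_set1 | exact: subring_setM].
have s_neq0 : s != 0.
  by rewrite subr_eq0; apply/eqP => /esym; exact: no_mulV.
have [n [b Ab Hb]] : exists n, exists2 b, A b & s ^+ n * e^-1 = b.
  exists (size p); eexists; last by reflexivity.
  rewrite -Hp horner_coef big_distrr /=; apply: subring_set_sum => // i _.
  rewrite mulrCA; apply: subring_setM => //.
  rewrite exprVn -expfB_cond ?(negPf s_neq0) ?(ltnW (ltn_ord i)) //.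
  exact: subring_setX.
have [d Ad Hd] : exists2 d, A d & s ^+ n = 1 - e * d.
  elim: n {Hb} => [|n [d Ad Hd]].
    by exists 0; [exact: subring_set0 | rewrite mulr0 subr0].
  exists (d + s ^+ n * a); last by rewrite exprSr [in LHS]/s mulrBr Hd; ring.
  apply: subring_setD => //; apply: subring_setM => //; exact: subring_setX.
apply: (@no_mulV (b + d)); first exact: subring_setD.
by rewrite -Hb mulrDr mulrCA divff // mulr1 Hd subrK.
Qed.

(* The relation for [t^-1] is used to rewrite the leading power of [t] in the
   relation for [t], which lowers the degree of the latter. *)
Lemma maximal_subring_relation (n m : nat) t (p q : {poly K}) :
    t != 0 -> poly_over_set A p -> poly_over_set A q ->
    (size p <= n.+1)%N -> (size q <= m.+1)%N ->
  e * p.[t] = 1 -> e * q.[t^-1] = 1 -> False.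
Proof.
have [k] := ubnP (n + m)%N.
elim: k n m t p q => // k IHk n m t p q ltnmk t0 Ap Aq szp szq pt qt.
wlog lemn : n m t p q t0 ltnmk Ap Aq szp szq pt qt / (m <= n)%N.
  move=> W; have [mn|/ltnW nm] := leqP m n; first exact: (W n m t p q).
  by apply: (W m n t^-1 q p); rewrite ?invr_eq0 ?invrK // addnC.
case: n => [|n] in ltnmk szp lemn.
  by apply: (no_mulV (Ap 0%N)); rewrite (size1_polyC szp) hornerC in pt.
(* Multiplied by [t ^+ n.+1], the relation for [t^-1] reads [t ^+ n.+1 * s = e * r.[t]], and [s] is
   invertible in [A] by [maximal_subring_unit]. *)
pose s := 1 - e * q`_0.
have s_neq0 : s != 0.
  by rewrite subr_eq0; apply/eqP => /esym; exact: no_mulV.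
pose r := \sum_(j < m) q`_j.+1 *: 'X^(n - j).
have rt : e * r.[t] = t ^+ n.+1 * s.
  have -> : s = e * \sum_(j < m) q`_j.+1 * t^-1 ^+ j.+1.
    apply/eqP; rewrite subr_eq -qt (horner_coef_wide _ szq) big_ord_recl.
    by rewrite expr0 mulr1 mulrDr addrC.
  rewrite mulrCA; congr (_ * _); rewrite /r horner_sum big_distrr /=.
  apply: eq_bigr => j _; rewrite hornerZ hornerXn mulrCA; congr (_ * _).
  have jn : (j.+1 <= n.+1)%N by apply: leq_trans lemn.
  by rewrite exprVn -expfB_cond ?(negPf t0) // subSS.
have Ar : poly_over_set A r.
  move=> i; rewrite /r coef_sum; apply: subring_set_sum => // j _.
  rewrite coefZ coefXn; apply: subring_setM => //.
  by case: (i == _); [exact: subring_set1 | exact: subring_set0].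
pose p' := \poly_(i < n.+1) p`_i + (p`_n.+1 * (s^-1 * e)) *: r.
apply: (IHk n m t p' q) => //.
- move=> i; rewrite coefD coef_poly coefZ; apply: subring_setD => //.
    by case: ifP => // _; exact: subring_set0.
  apply: subring_setM => //; do 2! apply: subring_setM => //.
  exact: maximal_subring_unit.
- rewrite (leq_trans (size_polyD _ _)) // geq_max size_poly /=.
  apply: leq_trans (size_scale_leq _ _) _; apply: leq_trans (size_sum _ _ _) _.
  apply/bigmax_leqP => j _; apply: leq_trans (size_scale_leq _ _) _.
  by rewrite size_polyXn ltnS leq_subr.
- rewrite hornerD hornerZ -mulrA -[s^-1 * e * _]mulrA rt.
  rewrite [t ^+ _ * s]mulrC mulKf //.
  rewrite -pt (horner_coef_wide _ szp) big_ord_recr /= horner_poly.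
  by [].
Qed.

(** If both fail, maximality writes [e^-1] as a polynomial in [t] and as one in [t^-1], which
    [maximal_subring_relation] excludes. *)
Lemma maximal_subring_valuation t : A t \/ A t^-1.
Proof.
have [At|nAt] := pselect (A t); [by left | right; apply: contrapT => nAVt].
have t0 : t != 0.
  by apply/eqP => t0; apply: nAt; rewrite t0; exact: subring_set0.
have [p Ap Hp] := Amax nAt; have [q Aq Hq] := Amax nAVt.
apply: (@maximal_subring_relation (size p) (size q) t p q) => //.
by rewrite Hp divff.
by rewrite Hq divff.
Qed.

End MaximalSubring.

(** Chevalley's argument: Zorn's lemma gives a subring maximal among those that contain [A0] but not
    [e^-1], and such a subring is a valuation ring. *)
Lemma exists_valuation_subring (K : fieldType) (A0 : set K) (e : K) :
    subring_set A0 -> A0 e -> ~ A0 e^-1 ->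
  exists A : set K,
    [/\ subring_set A, A e, ~ A e^-1 & forall t, A t \/ A t^-1].
Proof.
move=> A0ring A0e nA0e.
(* The disjunct [set0] accommodates the union of the empty chain. *)
pose P (X : set K) := X = set0 \/ [/\ subring_set X, A0 `<=` X & ~ X e^-1].
have [F FP Ftot|A [PA Amax]] := @Zorn_bigcup K P.
  have [[X [FX [x Xx]]]|F0] := pselect (exists X, F X /\ X !=set0); last first.
    left; rewrite -subset0 => x [X FX Xx]; apply: F0; exists X; split => //.
    by exists x.
  have FPne Y y : F Y -> Y y -> [/\ subring_set Y, A0 `<=` Y & ~ Y e^-1].
    by move=> FY Yy; case: (FP _ FY) => // Y0; rewrite Y0 in Yy.
  have [Xr A0X _] := FPne _ _ FX Xx.
  (* Two elements of the union lie in a common member of the chain, where closure can be checked. *)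
  have join y z : (\bigcup_(X in F) X)%classic y ->
      (\bigcup_(X in F) X)%classic z -> exists Y, [/\ F Y, Y y & Y z].
    move=> [Y FY Yy] [Z FZ Zz]; have [YZ|ZY] := Ftot _ _ FY FZ.
      by exists Z; split => //; exact: YZ.
    by exists Y; split => //; exact: ZY.
  right; split; last by case=> Y FY Ye; have [_ _] := FPne _ _ FY Ye; exact.
    split=> [|y z Hy Hz|y z Hy Hz].
    - by exists X => //; exact: subring_set1.
    - have [Y [FY Yy Yz]] := join _ _ Hy Hz; exists Y => //.
      by have [Yr _ _] := FPne _ _ FY Yy; exact: subring_setB.
    - have [Y [FY Yy Yz]] := join _ _ Hy Hz; exists Y => //.
      by have [Yr _ _] := FPne _ _ FY Yy; exact: subring_setM.
  by move=> a A0a; exists X => //; exact: A0X.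
have [A00|[Aring A0A nAe]] := PA.
  (* The maximal set is not empty, since [A0] would be strictly larger. *)
  exfalso; apply: (Amax A0); last by right; split.
  rewrite A00; split; first exact: sub0set.
  by move/(_ e A0e).
exists A; split => //; first exact: A0A.
apply: (@maximal_subring_valuation _ _ e) => // [|t nAt]; first exact: A0A.
apply: contrapT => nBe; apply: (Amax (adjoin_set A t)).
  split; first exact: sub_adjoin_set.
  by move=> BA; apply: nAt; apply: BA; exact: mem_adjoin_set.
right; split => //; first exact: subring_set_adjoin.
by apply: subset_trans A0A _; exact: sub_adjoin_set.
Qed.

(** The divisor [a] is an entry of least valuation. In the induction a nonzero [c] replaces [a] when
    it is [c^-1 * a] that lies in [A]. *)
Lemma valuation_subring_scale (K : fieldType) (A : set K) (s : seq K) :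
    subring_set A -> (forall t, A t \/ A t^-1) -> has (predC1 0) s ->
  exists a, [/\ a \in s, a != 0 & {in s, forall b, A (a^-1 * b)}].
Proof.
move=> Ar Aval; elim: s => // c s IHs /=; have A1 := subring_set1 Ar.
have [s_neq0 _|s_eq0] := boolP (has (predC1 0) s); last first.
  rewrite orbF => /= c_neq0; exists c; split=> //; first exact: mem_head.
  move=> b; rewrite inE => /predU1P[->|bs]; first by rewrite mulVf.
  move/hasPn: s_eq0 => /(_ b bs) /=; rewrite negbK => /eqP->.
  by rewrite mulr0; exact: subring_set0.
have [a [a_s a_neq0 Aa]] := IHs s_neq0.
have [Ac|] := Aval (a^-1 * c).
  exists a; split=> // [|b]; first by rewrite inE a_s orbT.
  by rewrite inE => /predU1P[->|/Aa].
(* As [0^-1 = 0], this alternative does not rule out [c = 0], where [a] is kept. *)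
have [->|c_neq0] := eqVneq c 0 => Ac.
  exists a; split=> // [|b]; first by rewrite inE a_s orbT.
  rewrite inE => /predU1P[->|/Aa//].
  by rewrite mulr0; exact: subring_set0.
exists c; split=> // [|b]; first exact: mem_head.
rewrite inE => /predU1P[->|/Aa Ab]; first by rewrite mulVf.
have -> : c^-1 * b = (a^-1 * c)^-1 * (a^-1 * b) by field; rewrite c_neq0 a_neq0.
exact: subring_setM.
Qed.

(** * Squares of polynomials modulo 2 *)

(** Cross terms occur twice in a square. The subring is arbitrary so that the lemma also applies
    with polynomials over [A] as coefficients. *)
Lemma coef_sqr_mod2 (R : comNzRingType) (A : set R) (p : {poly R}) :
    subring_set A -> poly_over_set A p ->
  exists2 q, poly_over_set A q & forall k,
    (p ^+ 2)`_k = (if odd k then 0 else p`_k./2 ^+ 2) + q`_k *+ 2.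
Proof.
move=> Ar; elim/poly_ind: p => [_|p c IHp Apc].
  exists 0 => [i|k]; first by rewrite coef0; exact: subring_set0.
  by rewrite expr0n /= !coef0 expr0n mul0rn addr0 if_same.
have Ac : A c by have := Apc 0%N; rewrite coefD coefMX coefC add0r.
have Ap i : A p`_i by have := Apc i.+1; rewrite coefD coefMX coefC addr0.
have [q Aq Hq] := IHp Ap.
exists (q * 'X^2 + c *: (p * 'X)) => [i|k].
  rewrite coefD coefMXn coefZ coefMX; apply: subring_setD => //.
    by case: ifP => // _; exact: subring_set0.
  apply: subring_setM => //.
  by case: ifP => // _; exact: subring_set0.
have -> : (p * 'X + c%:P) ^+ 2 =
    p ^+ 2 * 'X^2 + (c *: (p * 'X)) *+ 2 + (c ^+ 2)%:P.
  by rewrite -mul_polyC polyCM; ring.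
rewrite !coefD !coefMXn !coefZ !coefMX !coefC.
case: k => [|[|k]] /=; first by ring.
  by ring.
rewrite Hq negbK subn2 /=; case: (odd k) => //=; ring.
Qed.

Definition mod2 (R : pzRingType) (A : set R) : set R :=
  [set a *+ 2 | a in A].

Section Mod2.
Variables (R : comNzRingType) (A : set R).
Hypothesis Aring : subring_set A.

Lemma mod2_0 : mod2 A 0.
Proof. by exists 0; [exact: subring_set0 | rewrite mul0rn]. Qed.

Lemma mod2B x y : mod2 A x -> mod2 A y -> mod2 A (x - y).
Proof.
by move=> [a Aa <-] [b Ab <-]; exists (a - b);
  [exact: subring_setB | rewrite mulrnBl].
Qed.

Lemma mod2N x : mod2 A x -> mod2 A (- x).
Proof. by rewrite -sub0r; exact/mod2B/mod2_0. Qed.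

Lemma mod2D x y : mod2 A x -> mod2 A y -> mod2 A (x + y).
Proof. by move=> Hx Hy; rewrite -[y]opprK; exact/mod2B/mod2N. Qed.

Definition poly2_over : set {poly {poly R}} := poly_over_set (poly_over_set A).

(** The univariate case is used in the outer variable Y over [A[X]], then in X over [A]. The first
    index is the exponent of Y. *)
Lemma bicoef_sqr_mod2 (p : {poly {poly R}}) i j : poly2_over p ->
  mod2 A ((p ^+ 2)`_j`_i -
          (if odd i || odd j then 0 else p`_j./2`_i./2 ^+ 2)).
Proof.
move=> Ap; have [q Aq ->] := coef_sqr_mod2 (subring_set_poly Aring) Ap.
rewrite coefD coefMn; case: (odd j) => /=.
  by rewrite coef0 orbT subr0 add0r; exists q`_j`_i => //; exact: Aq.
have [r Ar ->] := coef_sqr_mod2 Aring (Ap j./2).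
rewrite orbF; set z := (if _ then _ else _).
exists (r`_i + q`_j`_i); last by rewrite mulrnDl; ring.
apply: subring_setD => //; exact: Aq.
Qed.

Lemma mod2_eq x y : mod2 A x -> x = y -> mod2 A y.
Proof. by move=> + <-. Qed.

(* Booleans encode exponents, as only their parities matter. *)
Definition mono (m : bool * bool) : {poly {poly R}} :=
  ('X ^+ m.1)%:P * 'X ^+ m.2.

(** There are no signs: negative terms of the quaternion forms are moved to the other side of an
    equation. *)
Definition mono_form (s : seq (bool * bool * {poly {poly R}})) :
    {poly {poly R}} :=
  \sum_(t <- s) mono t.1 * t.2 ^+ 2.

(** Modulo 2, a monomial times a square only involves exponents with the parities of that
    monomial. *)
Lemma coef_mono_sqr_mod2 (m n : bool * bool) i j p : poly2_over p ->
  mod2 A ((mono m * p ^+ 2)`_(n.2 + j.*2)`_(n.1 + i.*2) -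
          (if m == n then p`_j`_i ^+ 2 else 0)).
Proof.
move: m n => [e f] [a b] Ap; rewrite /mono -mulrA coefCM !coefXnM -pair_eqE /=.
(* An exponent below that of the monomial is 0 against 1: the parities differ and both sides
   vanish. *)
have ltE (c g : bool) k : (c + k.*2 < g)%N -> (g == c) = false.
  by case: c; case: g; case: k.
have oddE (c g : bool) k : ~~ (c + k.*2 < g)%N ->
    odd (c + k.*2 - g) = (g != c).
  by case: c; case: g; case: k => // k _; rewrite ?subn0 ?subn1 /= ?odd_double.
rewrite /pair_eq /=.
case: ifPn => [/ltE->|gea]; first by rewrite subr0; exact: mod2_0.
case: ifPn => [/ltE->|geb]; first by rewrite coef0 andbF subr0; exact: mod2_0.
have := bicoef_sqr_mod2 (a + i.*2 - e) (b + j.*2 - f) Ap.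
rewrite !oddE // -negb_and.
case: andP => //= -[/eqP-> /eqP->].
by rewrite !addKn !doubleK.
Qed.

Lemma coef_mono_form_mod2 s (n : bool * bool) i j :
    (forall t, t \in s -> poly2_over t.2) ->
  mod2 A ((mono_form s)`_(n.2 + j.*2)`_(n.1 + i.*2) -
          \sum_(t <- s | t.1 == n) t.2`_j`_i ^+ 2).
Proof.
move=> sA; rewrite /mono_form !coef_sum [X in _ - X]big_mkcond.
rewrite -sumrB big_seq; apply: big_ind => [|x y|t /sA tA].
- exact: mod2_0.
- exact: mod2D.
- exact: coef_mono_sqr_mod2.
Qed.

(** An equation of forms splits into one congruence for each parity class [n]. *)
Lemma mono_form_eq_mod2 s s' (n : bool * bool) i j :
    mono_form s = mono_form s' ->
    (forall p, p \in unzip2 (s ++ s') -> poly2_over p) ->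
  mod2 A (\sum_(t <- s | t.1 == n) t.2`_j`_i ^+ 2 -
          \sum_(t <- s' | t.1 == n) t.2`_j`_i ^+ 2).
Proof.
move=> E ssA.
have sA t : t \in s -> poly2_over t.2.
  by move=> ts; apply: ssA; rewrite map_f // mem_cat ts.
have s'A t : t \in s' -> poly2_over t.2.
  by move=> ts; apply: ssA; rewrite map_f // mem_cat ts orbT.
have := mod2B (coef_mono_form_mod2 n i j s'A) (coef_mono_form_mod2 n i j sA).
move/mod2_eq; apply.
by rewrite E; ring.
Qed.

(* Modulo 2 the square of a polynomial only involves monomials of even
   bidegree, so the four forms take values in four hyperplanes of the space
   with basis 1, X, Y, XY over the squares, and these meet in 0.  The summand
   Y (XY) z3^2 of the last form is read as X (Y z3)^2. *)
Lemma four_forms_mod2 (u1 u2 u3 v1 v2 v3 w1 w2 w3 z1 z2 z3 : {poly {poly R}}) :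
    let m0 := (false, false) in let mX := (true, false) in
    let mY := (false, true) in let mXY := (true, true) in
    let S := [:: u1; u2; u3; v1; v2; v3; w1; w2; w3; z1; z2; z3] in
    {in S, forall p, poly2_over p} ->
    mono_form [:: (mX, u1); (mY, u2); (mXY, v3); (mX, v3)] =
      mono_form [:: (mX, v1); (mY, v2); (m0, v2); (mXY, u3)] ->
    mono_form [:: (mX, u1); (mY, u2); (mXY, w3); (mY, w3)] =
      mono_form [:: (mY, w1); (mX, w2); (m0, w2); (mXY, u3)] ->
    mono_form [:: (mX, u1); (mY, u2); (mX, 'X * z3); (mY, z3)] =
      mono_form [:: (mY, z1); (mXY, z2); (m0, z2); (mXY, u3)] ->
  {in S, forall (p : {poly {poly R}}) i j, mod2 A (p`_j`_i ^+ 2)}.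
Proof.
move=> m0 mX mY mXY S; rewrite /S => {S} SA E1 E2 E3.
have XzA : poly2_over ('X * z3).
  move=> k l; rewrite coefXM; case: ifP => _.
    by rewrite coef0; exact: subring_set0.
  by apply: SA; rewrite !inE eqxx ?orbT.
pose sq i j (p : {poly {poly R}}) := p`_j`_i ^+ 2.
pose S' := [:: 'X * z3; u1; u2; u3; v1; v2; v3; w1; w2; w3; z1; z2; z3].
have L s s' n i j :
    mono_form s = mono_form s' -> all [in S'] (unzip2 (s ++ s')) ->
    mod2 A (\sum_(t <- s | t.1 == n) t.2`_j`_i ^+ 2 -
            \sum_(t <- s' | t.1 == n) t.2`_j`_i ^+ 2).
  move=> E /allP sub; apply: mono_form_eq_mod2 E _ => p /sub.
  by rewrite inE => /predU1P[->|/SA].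
have L1 n i j := L _ _ n i j E1 ltac:(by rewrite /S' /= !inE !eqxx ?orbT).
have L2 n i j := L _ _ n i j E2 ltac:(by rewrite /S' /= !inE !eqxx ?orbT).
have L3 n i j := L _ _ n i j E3 ltac:(by rewrite /S' /= !inE !eqxx ?orbT).
pose sumE := (big_cons, big_nil, xpair_eqE).
(* The class of 1 yields [v2], [w2], [z2]; the class of XY then [u3], [v3], [w3]; the classes of X
   and Y the others, [z3] before [z1]. *)
have v2E i j : mod2 A (sq i j v2).
  by apply: mod2_eq (mod2N (L1 m0 i j)) _; rewrite /sq !sumE /=; ring.
have w2E i j : mod2 A (sq i j w2).
  by apply: mod2_eq (mod2N (L2 m0 i j)) _; rewrite /sq !sumE /=; ring.
have z2E i j : mod2 A (sq i j z2).
  by apply: mod2_eq (mod2N (L3 m0 i j)) _; rewrite /sq !sumE /=; ring.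
have u3E i j : mod2 A (sq i j u3).
  apply: mod2_eq (mod2N (mod2D (L3 mXY i j) (z2E i j))) _.
  by rewrite /sq !sumE /=; ring.
have v3E i j : mod2 A (sq i j v3).
  apply: mod2_eq (mod2D (L1 mXY i j) (u3E i j)) _.
  by rewrite /sq !sumE /=; ring.
have w3E i j : mod2 A (sq i j w3).
  apply: mod2_eq (mod2D (L2 mXY i j) (u3E i j)) _.
  by rewrite /sq !sumE /=; ring.
have u2E i j : mod2 A (sq i j u2).
  apply: mod2_eq (mod2D (L1 mY i j) (v2E i j)) _.
  by rewrite /sq !sumE /=; ring.
have u1E i j : mod2 A (sq i j u1).
  apply: mod2_eq (mod2D (L2 mX i j) (w2E i j)) _.
  by rewrite /sq !sumE /=; ring.
have v1E i j : mod2 A (sq i j v1).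
  apply: mod2_eq (mod2B (mod2D (u1E i j) (v3E i j)) (L1 mX i j)) _.
  by rewrite /sq !sumE /=; ring.
have w1E i j : mod2 A (sq i j w1).
  apply: mod2_eq (mod2B (mod2D (u2E i j) (w3E i j)) (L2 mY i j)) _.
  by rewrite /sq !sumE /=; ring.
have z3E i j : mod2 A (sq i j z3).
  (* Here ['X] is Y, so the coefficient of [z3] at [j] is that of ['X * z3] at [j.+1]. *)
  apply: mod2_eq (mod2B (L3 mX i j.+1) (u1E i j.+1)) _.
  by rewrite /sq !sumE /= coefXM /=; ring.
have z1E i j : mod2 A (sq i j z1).
  apply: mod2_eq (mod2B (mod2D (u2E i j) (z3E i j)) (L3 mY i j)) _.
  by rewrite /sq !sumE /=; ring.
move=> p + i j; rewrite -/(sq i j p) !inE.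
by do 11! [case/predU1P=> [->//|]]; move/eqP->.
Qed.
End Mod2.

(** * Quadratic subfields and pure quaternions *)

(** Completing the square: 1 and any [w] outside the base field span [L], so [w ^+ 2 = q + p w], and
    [w - p/2] has a scalar square. *)
Lemma quadratic_ext_sqrt (F : fieldType) (L : fieldExtType F) :
    (2%:R : F) != 0 -> \dim {: L} = 2%N ->
  exists (w : L) (c : F), w \notin 1%VS /\ w ^+ 2 = c%:A.
Proof.
move=> two_neq0 dimL.
have [w _ w1] : exists2 w, w \in {: L}%VS & w \notin 1%VS.
  apply/subvPn; apply/negP => /dimvS; by rewrite dimL dimv1.
have w0 : w != 0 by apply: contraNneq w1 => ->; exact: mem0v.
have full : (1 + <[w]> = {: L})%VS.
  apply/eqP; rewrite eqEdim subvf dimL dimv_disjoint_sum.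
    by rewrite dimv1 dim_vline w0.
  apply/eqP; rewrite -subv0; apply/subvP => x; rewrite memv_cap memv0.
  move=> /andP[x1 /vlineP[k Hk]]; move: x1; rewrite Hk.
  have [->|k0] := eqVneq k 0; first by rewrite scale0r.
  by move/(memvZ k^-1); rewrite scalerA mulVf // scale1r (negPf w1).
have : w ^+ 2 \in (1 + <[w]>)%VS by rewrite full memvf.
case/memv_addP => _ /vlineP[q ->] [_ /vlineP[p ->]] Hw.
exists (w - (p / 2%:R)%:A), (q + (p / 2%:R) ^+ 2); split.
  apply: contra w1 => H; rewrite -(subrK (p / 2%:R)%:A w) rpredD //.
  by rewrite rpredZ // mem1v.
rewrite sqrrB Hw.
have -> : w * (p / 2%:R)%:A *+ 2 = p *: w.
  by rewrite -scalerAr mulr1 -scaler_nat scalerA mulrC divfK.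
rewrite expr2 -[(_ *: _) * _]scalerAl mul1r scalerA scalerDl expr2.
by rewrite addrK.
Qed.

(** If the image of [w] has scalar part [e], the other coordinates of its square are [2 e x],
    [2 e y], [2 e z], all 0. Injectivity keeps [x], [y], [z] from all vanishing, so [e = 0]. *)
Lemma embeds_in_quat_pure (F : fieldType) (a b : F) (L : fieldExtType F)
    (w : L) (c : F) :
    (2%:R : F) != 0 -> w \notin 1%VS -> w ^+ 2 = c%:A -> embeds_in_quat L a b ->
  exists x y z : F, c = a * x ^+ 2 + b * y ^+ 2 - a * b * z ^+ 2 /\
    ~ [/\ x = 0, y = 0 & z = 0].
Proof.
move=> two_neq0 w1 w2 [f [finj flin f1 fM]].
have fZ (k : F) : f k%:A = Quat a b k 0 0 0.
  have f0 : f 0 = Quat a b 0 0 0 0.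
    have := flin (-1) 0 0; rewrite scaler0 addr0; case: (f 0) => e0 e1 e2 e3.
    by rewrite /qadd /qscale /= !mulN1r !addNr.
  have := flin k 1 0; rewrite addr0 f1 f0 /qadd /qscale /= => ->.
  by rewrite !addr0 mulr1 !mulr0.
have := fM w w; rewrite -expr2 w2 fZ; case fw : (f w) => [e x y z].
rewrite /qmul /= => -[Hc H1 H2 H3].
have nsc : ~ [/\ x = 0, y = 0 & z = 0].
  case=> x0 y0 z0; case/negP: w1; have -> : w = e%:A;
    last by rewrite rpredZ ?mem1v.
  by apply: finj; rewrite fw fZ x0 y0 z0.
have e0 : e = 0.
  apply/eqP; apply: contra_notT nsc => e_neq0.
  have e2 : e * 2%:R != 0 by rewrite mulf_neq0.
  by split; apply: (mulfI e2); rewrite mulr0;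
    [rewrite [RHS]H1 | rewrite [RHS]H2 | rewrite [RHS]H3]; ring.
exists x, y, z; split => //; rewrite Hc e0; ring.
Qed.

(** * Clearing denominators and descent to the congruences modulo 2 *)

Lemma common_denominator (R : idomainType) (s : seq {fraction R}) :
  exists2 d : R, d != 0 & exists r : {fraction R} -> R,
    {in s, forall x, FracField.tofrac d * x = FracField.tofrac (r x)}.
Proof.
elim: s => [|x s [d d_neq0 [r Hr]]].
  by exists 1; [exact: oner_neq0 | exists (fun=> 0)].
have [n [m m_neq0 Hx]] : exists n, exists2 m : R, m != 0 &
    FracField.tofrac m * x = FracField.tofrac n.
  elim/quotW: x => x; exists (frac x).1, (frac x).2; first exact: denom_ratioP.
  unlock FracField.tofrac; rewrite -[LHS]FracField.pi_mul; apply/eqmodP => /=.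
  rewrite FracField.equivfE /FracField.mulf /=.
  rewrite !numden_Ratio ?mulf_neq0 ?oner_eq0 ?denom_ratioP //.
  by rewrite !mul1r !mulr1 mulrC.
exists (m * d); first by rewrite mulf_neq0.
exists (fun y => if y == x then d * n else m * r y) => y.
rewrite inE; have [-> _|_ /= /Hr Hy] := eqVneq y x.
  by rewrite [m * d]mulrC !tofracM -mulrA Hx.
by rewrite !tofracM -mulrA Hy.
Qed.

(** An integer [n] equal to 1/2 in [K] would make the odd integer [2n - 1] vanish there, against
    characteristic 0. *)
Lemma int_subring_half (K : fieldType) : [pchar K] =i pred0 ->
  let Z := [set n%:~R | n in [set: int]] : set K in
  [/\ subring_set Z, Z 2%:R & ~ Z 2%:R^-1].
Proof.
move=> charK Z; have natK := (pcharf0P K).1 charK.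
have two_neq0 : (2%:R : K) != 0 by rewrite natK.
split.
- split=> [|_ _ [m _ <-] [n _ <-]|_ _ [m _ <-] [n _ <-]].
  + by exists 1.
  + by exists (m - n) => //; rewrite intrB.
  + by exists (m * n) => //; rewrite intrM.
- by exists 2.
case=> n _ n_half; have /eqP : (2%:Z * n - 1)%:~R = 0 :> K.
  by rewrite intrB intrM n_half divff // subrr.
have odd_neq0 (m : nat) : (m.*2.+1%:R : K) != 0 by rewrite natK.
case: n {n_half} => n.
  case: n => [|n]; first by rewrite mulr0 sub0r mulrN1z oppr_eq0 oner_eq0.
  have -> : 2%:Z * n.+1 - 1 = n.*2.+1 by rewrite -muln2 /=; lia.
  exact/negP/odd_neq0.
have -> : 2%:Z * Negz n - 1 = - (n.+1.*2.+1)%:Z by rewrite -muln2; lia.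
by rewrite mulrNz oppr_eq0; exact/negP/odd_neq0.
Qed.

(** The equations are homogeneous, so a nonzero solution can be divided by a coefficient of least
    valuation; the congruences modulo 2 then contradict that some coefficient is 1. *)
Lemma four_forms_anisotropic (K : fieldType)
    (u1 u2 u3 v1 v2 v3 w1 w2 w3 z1 z2 z3 : {poly {poly K}}) :
    [pchar K] =i pred0 ->
    let X : {poly {poly K}} := 'X%:P in let Y : {poly {poly K}} := 'X in
    X * u1 ^+ 2 + Y * u2 ^+ 2 - X * Y * u3 ^+ 2 =
      X * v1 ^+ 2 + (Y + 1) * v2 ^+ 2 - X * (Y + 1) * v3 ^+ 2 ->
    X * u1 ^+ 2 + Y * u2 ^+ 2 - X * Y * u3 ^+ 2 =
      Y * w1 ^+ 2 + (X + 1) * w2 ^+ 2 - Y * (X + 1) * w3 ^+ 2 ->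
    X * u1 ^+ 2 + Y * u2 ^+ 2 - X * Y * u3 ^+ 2 =
      Y * z1 ^+ 2 + (X * Y + 1) * z2 ^+ 2 - Y * (X * Y + 1) * z3 ^+ 2 ->
  {in [:: u1; u2; u3; v1; v2; v3; w1; w2; w3; z1; z2; z3], forall p, p = 0}.
Proof.
move=> charK X Y E1 E2 E3; set S := [:: u1; _; _; _; _; _; _; _; _; _; _; _].
pose s : seq K :=
  flatten [seq flatten [seq polyseq q | q <- polyseq p] | p <- S].
have coef_s p i j : p \in S -> p`_j`_i = 0 \/ p`_j`_i \in s.
  move=> pS; have [szj|ltj] := leqP (size p) j.
    by left; rewrite (nth_default _ szj) coef0.
  have [szi|lti] := leqP (size p`_j) i; first by left; rewrite nth_default.
  right; apply/flatten_mapP; exists p => //.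
  by apply/flatten_mapP; exists p`_j; exact: mem_nth.
have s_coef a : a \in s -> exists p i j, p \in S /\ a = p`_j`_i.
  case/flatten_mapP=> p pS /flatten_mapP[q /(nthP 0)[j _ <-] /(nthP 0)[i _ <-]].
  by exists p, i, j.
have [s_neq0|s_eq0] := boolP (has (predC1 0) s); last first.
  move=> p pS; apply/polyP => j; apply/polyP => i; rewrite !coef0.
  have [//|/(hasPn s_eq0)] := coef_s p i j pS.
  by rewrite /= negbK => /eqP.
have [Zr Z2 Zhalf] := int_subring_half charK.
have [A [Ar A2 Ahalf Aval]] := exists_valuation_subring Zr Z2 Zhalf.
have [a [a_s a_neq0 Aa]] := valuation_subring_scale Ar Aval s_neq0.
pose k : {poly {poly K}} := (a^-1)%:P%:P.
have coef_k p i j : (k * p)`_j`_i = a^-1 * p`_j`_i by rewrite !coefCM.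
have [p [i [j [pS a_def]]]] := s_coef _ a_s.
(* The coefficient [a] has become 1; its square in [2A] would put 1/2 in [A]. *)
suff [b Ab b2] : mod2 A ((k * p)`_j`_i ^+ 2).
  rewrite coef_k -a_def mulVf // expr1n in b2; case: Ahalf.
  suff half : b = 2%:R^-1 by rewrite half in Ab.
  have two_neq0 : (2%:R : K) != 0 by rewrite ((pcharf0P K).1 charK).
  by apply: (mulIf two_neq0); rewrite mulVf // mulr_natr.
apply: (four_forms_mod2 Ar (u1 := k * u1) (u2 := k * u2) (u3 := k * u3)
  (v1 := k * v1) (v2 := k * v2) (v3 := k * v3) (w1 := k * w1) (w2 := k * w2)
  (w3 := k * w3) (z1 := k * z1) (z2 := k * z2) (z3 := k * z3)).
- move=> q qkS; have {qkS} /mapP[r rS ->] : q \in [seq k * r | r <- S] by [].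
  move=> j' i'; rewrite coef_k; have [->|/Aa//] := coef_s r i' j' rS.
  by rewrite mulr0; exact: subring_set0.
- rewrite /mono_form !big_cons !big_nil /mono /= !expr0 !expr1 -/X -/Y.
  apply/eqP; rewrite -subr_eq0; apply/eqP.
  transitivity (k ^+ 2 * ((X * u1 ^+ 2 + Y * u2 ^+ 2 - X * Y * u3 ^+ 2) -
    (X * v1 ^+ 2 + (Y + 1) * v2 ^+ 2 - X * (Y + 1) * v3 ^+ 2))); first ring.
  by rewrite E1 subrr mulr0.
- rewrite /mono_form !big_cons !big_nil /mono /= !expr0 !expr1 -/X -/Y.
  apply/eqP; rewrite -subr_eq0; apply/eqP.
  transitivity (k ^+ 2 * ((X * u1 ^+ 2 + Y * u2 ^+ 2 - X * Y * u3 ^+ 2) -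
    (Y * w1 ^+ 2 + (X + 1) * w2 ^+ 2 - Y * (X + 1) * w3 ^+ 2))); first ring.
  by rewrite E2 subrr mulr0.
- rewrite /mono_form !big_cons !big_nil /mono /= !expr0 !expr1 -/X -/Y.
  apply/eqP; rewrite -subr_eq0; apply/eqP.
  transitivity (k ^+ 2 * ((X * u1 ^+ 2 + Y * u2 ^+ 2 - X * Y * u3 ^+ 2) -
    (Y * z1 ^+ 2 + (X * Y + 1) * z2 ^+ 2 - Y * (X * Y + 1) * z3 ^+ 2)));
    first ring.
  by rewrite E3 subrr mulr0.
- exact: (map_f (fun r => k * r) pS).
Qed.

Lemma tofrac_inj (R : idomainType) : injective (@FracField.tofrac R).
Proof. by move=> p q /eqP; rewrite tofrac_eq => /eqP. Qed.

Lemma pchar_CC : [pchar CC] =i pred0.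
Proof. exact: (Num.Theory.pchar_num (complex Rdefinitions.R)). Qed.

Theorem theoremA :
  ~ exists L : fieldExtType FF,
      [/\ \dim {: L} = 2%N,
          embeds_in_quat L x1 x2,
          embeds_in_quat L x1 (x2 + 1),
          embeds_in_quat L x2 (x1 + 1) &
          embeds_in_quat L x2 (x1 * x2 + 1)].
Proof.
case=> L [dimL e1 e2 e3 e4].
have two_neq0 : (2%:R : FF) != 0.
  rewrite -(rmorph_nat (@FracField.tofrac {poly {poly CC}})) tofrac_eq0.
  by rewrite -!polyC_natr !polyC_eq0 ((pcharf0P CC).1 pchar_CC).
have [w [c [w1 w2]]] := quadratic_ext_sqrt two_neq0 dimL.
have pure a b := @embeds_in_quat_pure _ a b _ _ _ two_neq0 w1 w2.
have [u1 [u2 [u3 [Eu nz]]]] := pure _ _ e1.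
have [v1 [v2 [v3 [Ev _]]]] := pure _ _ e2.
have [t1 [t2 [t3 [Et _]]]] := pure _ _ e3.
have [z1 [z2 [z3 [Ez _]]]] := pure _ _ e4.
pose S := [:: u1; u2; u3; v1; v2; v3; t1; t2; t3; z1; z2; z3].
have [d d_neq0 [r Hr]] := common_denominator S.
(* Multiplied by the square of [d], the four expressions of [c] become polynomials with the same
   image in [FF], hence equal. *)
have form (a b : {poly {poly CC}}) x y z : x \in S -> y \in S -> z \in S ->
    c = FracField.tofrac a * x ^+ 2 + FracField.tofrac b * y ^+ 2 -
        FracField.tofrac a * FracField.tofrac b * z ^+ 2 ->
  FracField.tofrac (a * r x ^+ 2 + b * r y ^+ 2 - a * b * r z ^+ 2) =
    FracField.tofrac d ^+ 2 * c.
  move=> /Hr Hx /Hr Hy /Hr Hz ->.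
  rewrite !(rmorphB, rmorphD, rmorphM) /= -Hx -Hy -Hz; ring.
pose X : {poly {poly CC}} := 'X%:P; pose Y : {poly {poly CC}} := 'X.
have {}Eu := form X Y u1 u2 u3 ltac:(by rewrite !inE eqxx ?orbT)
  ltac:(by rewrite !inE eqxx ?orbT) ltac:(by rewrite !inE eqxx ?orbT) Eu.
have {}Ev := form X (Y + 1) v1 v2 v3 ltac:(by rewrite !inE eqxx ?orbT)
  ltac:(by rewrite !inE eqxx ?orbT) ltac:(by rewrite !inE eqxx ?orbT)
  ltac:(by rewrite rmorphD rmorph1).
have {}Et := form Y (X + 1) t1 t2 t3 ltac:(by rewrite !inE eqxx ?orbT)
  ltac:(by rewrite !inE eqxx ?orbT) ltac:(by rewrite !inE eqxx ?orbT)
  ltac:(by rewrite rmorphD rmorph1).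
have {}Ez := form Y (X * Y + 1) z1 z2 z3 ltac:(by rewrite !inE eqxx ?orbT)
  ltac:(by rewrite !inE eqxx ?orbT) ltac:(by rewrite !inE eqxx ?orbT)
  ltac:(by rewrite rmorphD rmorph1 rmorphM).
have all0 := four_forms_anisotropic pchar_CC
  (tofrac_inj (etrans Eu (esym Ev))) (tofrac_inj (etrans Eu (esym Et)))
  (tofrac_inj (etrans Eu (esym Ez))).
have num0 x : x \in S -> r x = 0 -> x = 0.
  move=> /Hr Hx rx0; have /eqP := Hx; rewrite rx0 tofrac0 mulf_eq0 tofrac_eq0.
  by rewrite (negPf d_neq0) => /eqP.
(* Vanishing numerators force [u1], [u2], [u3] to be 0, against the choice of [w] outside the base
   field. *)
by apply: nz; split; apply: num0; rewrite ?inE ?eqxx ?orbT //; apply: all0;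
  rewrite ?inE ?eqxx ?orbT.
Qed.
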